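(* Let $p$ be a prime, let $n\ge 1$, let $1 \le m_1 < m_2 < \cdots < m_n$ and $\lambda_1,\dots,\lambda_n \ge 1$ be integers, and let $G = \bigoplus_{i=1}^{n} Z(p^{m_{i}})^{\lambda_{i}}$. Put $|\lambda|_{j} = \sum_{i=1}^{j} \lambda_{i}$. Then \[ \# (X(G) / {\sim}) = S_{1}(G) + S_{2}(G) + S_{3}(G), \] where \begin{align*} S_{1}(G) &= \sum_{1 \leq k < m_{1}} k^{\lambda_{1}} \Big( (k+1)^{|\lambda|_{n} - \lambda_{1}} - k^{|\lambda|_{n} - \lambda_{1}} \Big),\\ S_{2}(G) &= \sum_{i=1}^{n-1} \sum_{m_{i} \leq k < m_{i+1}} m_{i}^{\lambda_{i}} \Big( \prod_{j=1}^{i-1} (m_{j}+1)^{\lambda_{j}} \Big) \Big( (k+1)^{|\lambda|_{n} - |\lambda|_{i}} - k^{|\lambda|_{n} - |\lambda|_{i}} \Big),\\ S_{3}(G) &= \sum_{i=1}^{n-1} \sum_{m_{i} < k < m_{i+1}} k^{\lambda_{i+1}} \Big((m_{i}+1)^{\lambda_{i}} - m_{i}^{\lambda_{i}} \Big) \Big( \prod_{j=1}^{i-1} (m_{j}+1)^{\lambda_{j}} \Big) \Big( (k+1)^{|\lambda|_{n} - |\lambda|_{i+1}} - k^{|\lambda|_{n} - |\lambda|_{i+1}} \Big). \end{align*} Furthermore, \[ \# X(G) = T_{1}(G) + T_{2}(G) + T_{3}(G), \] where \begin{align*} T_{1}(G) &= \sum_{1 \leq k < m_{1}} p^{(k-1)\lambda_{1}}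 \cdot \frac{p^{k(|\lambda|_{n}- \lambda_{1})} - p^{(k-1)(|\lambda|_{n}- \lambda_{1})}}{p^{k-1}(p-1)},\\ T_{2}(G) &= \sum_{i=1}^{n-1} \sum_{m_{i} \leq k < m_{i+1}} \Big( \prod_{j=1}^{i-1} p^{m_{j}\lambda_{j}} \Big) p^{(m_{i}-1)\lambda_{i}} \cdot \frac{p^{k(|\lambda|_{n}- |\lambda|_{i})} - p^{(k-1)(|\lambda|_{n}- |\lambda|_{i})}}{p^{k-1}(p-1)},\\ T_{3}(G) &= \sum_{i=1}^{n-1} \sum_{m_{i} < k < m_{i+1}} \Big( \prod_{j=1}^{i-1} p^{m_{j}\lambda_{j}} \Big) \big(p^{m_{i}\lambda_{i}} - p^{(m_{i}-1)\lambda_{i}}\big) p^{(k-1)\lambda_{i+1}} \cdot \frac{p^{k(|\lambda|_{n}- |\lambda|_{i+1})} - p^{(k-1)(|\lambda|_{n}- |\lambda|_{i+1})}}{p^{k-1}(p-1)}. \end{align*} Here $k$ ranges over integers, empty sums are $0$ and empty products are $1$.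
   Context: $Z(p^{r}) = \mathbb{Z}/p^{r}\mathbb{Z}$. For a finite abelian group $G$, $X(G)$ is the set of cyclic subgroups $H$ of $G$ for which there exists $f \in \operatorname{Hom}(H,G)$ such that $F|_H \ne f$ for every $F \in \operatorname{End}(G)$. For $x \in Z(p^r)$, $v_p(x)$ is the largest non-negative integer $k$ such that $x = m p^k$ for some integer $m$ not divisible by $p$ if $x\neq 0$, and $v_p(0)=r$. Let $G=\bigoplus_{i=1}^N Z(p^{\mu_i})$ be written as a direct sum of cyclic groups (here the $N=|\lambda|_n$ cyclic summands of $\bigoplus_{i} Z(p^{m_i})^{\lambda_i}$). For cyclic subgroups $H=\langle (h_1,\dots,h_N)\rangle$ and $H'=\langle (h'_1,\dots,h'_N)\rangle$ of $G$, define $H\sim H'$ if and only if $v_p(h_i)=v_p(h'_i)$ for all $i$; this does not depend on the choice of generators and is an equivalence relation. $X(G)/{\sim}$ is the set of equivalence classes of $\sim$ on $X(G)$, and $\#$ denotes cardinality. *)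

(* Defs.v *)
From mathcomp Require Import all_boot all_order all_algebra all_fingroup all_solvable.

Set Implicit Arguments.
Unset Strict Implicit.
Unset Printing Implicit Defensive.

Import GRing.Theory.

(* Homomorphisms A -> B are represented by functions on the ambient type that
   are multiplicative on A and send A into B; values outside A are irrelevant. *)
Definition is_hom (gT rT : finGroupType) (A : {set gT}) (B : {set rT})
    (f : gT -> rT) : bool :=
  morphic A f && (f @: A \subset B).

Definition Xset (gT : finGroupType) (G : {group gT}) : {set {group gT}} :=
  [set H : {group gT} |
    [&& H \subset G, cyclic H &
      [exists f : {ffun gT -> gT},
        is_hom H G f &&
        [forall F : {ffun gT -> gT},
          is_hom G G F ==> ~~ [forall x in H, F x == f x]]]]].

(* The elements of 'Z_(p ^ r) are the residues 0, ..., p ^ r - 1; for x != 0 the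
   p-adic valuation of this representative is that of any other one. *)
Definition vp (p r : nat) (x : 'Z_(p ^ r)) : nat :=
  if x == 0%R then r else logn p (x : nat).

Arguments vp p r x : clear implicits.

(* The parameters m_1, ..., m_n and lambda_1, ..., lambda_n are the values at
   1, ..., n of functions on nat; the ordinal i : 'I_n stands for index i.+1.
   The finite group structure is the componentwise one; each 'Z_(p ^ r) is taken
   as an additive group, so that the group law written * below is addition. *)
Definition abgroup (p n : nat) (m lam : nat -> nat) : finGroupType :=
  {dffun forall i : 'I_n,
    {dffun forall j : 'I_(lam i.+1), 'Z_(p ^ m i.+1)}}.

Fact abgroup_mulE (p n : nat) (m lam : nat -> nat) (g h : abgroup p n m lam)
    (i : 'I_n) (j : 'I_(lam i.+1)) :
  (g * h)%g i j = (g i j + h i j)%R.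
Proof. by rewrite !ffunE. Qed.

Definition sim (p n : nat) (m lam : nat -> nat)
    (H H' : {group abgroup p n m lam}) : bool :=
  [exists h : abgroup p n m lam, exists h' : abgroup p n m lam,
    [&& H :==: <[h]>%g, H' :==: <[h']>%g &
      [forall i : 'I_n, forall j : 'I_(lam i.+1),
        vp p (m i.+1) (h i j) == vp p (m i.+1) (h' i j)]]].

Definition psum (lam : nat -> nat) (j : nat) : nat :=
  \sum_(1 <= i < j.+1) lam i.

(* The sums below are rational numbers, with rational subtraction and division.
   Truncated subtraction of naturals occurs only in exponents, where
   k, m_i >= 1 and |lambda|_i <= |lambda|_n make it exact. *)
Local Open Scope ring_scope.

Definition sumS1 (n : nat) (m lam : nat -> nat) : rat :=
  \sum_(1 <= k < m 1%N)
    k%:R ^+ lam 1%N *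
    ((k + 1)%:R ^+ (psum lam n - lam 1%N) - k%:R ^+ (psum lam n - lam 1%N)).

Definition sumS2 (n : nat) (m lam : nat -> nat) : rat :=
  \sum_(1 <= i < n) \sum_(m i <= k < m i.+1)
    (m i)%:R ^+ lam i *
    (\prod_(1 <= j < i) (m j + 1)%:R ^+ lam j) *
    ((k + 1)%:R ^+ (psum lam n - psum lam i)
     - k%:R ^+ (psum lam n - psum lam i)).

Definition sumS3 (n : nat) (m lam : nat -> nat) : rat :=
  \sum_(1 <= i < n) \sum_((m i).+1 <= k < m i.+1)
    k%:R ^+ lam i.+1 *
    ((m i + 1)%:R ^+ lam i - (m i)%:R ^+ lam i) *
    (\prod_(1 <= j < i) (m j + 1)%:R ^+ lam j) *
    ((k + 1)%:R ^+ (psum lam n - psum lam i.+1)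
     - k%:R ^+ (psum lam n - psum lam i.+1)).

Definition sumT1 (p n : nat) (m lam : nat -> nat) : rat :=
  \sum_(1 <= k < m 1%N)
    p%:R ^+ ((k - 1) * lam 1%N) *
    ((p%:R ^+ (k * (psum lam n - lam 1%N))
      - p%:R ^+ ((k - 1) * (psum lam n - lam 1%N)))
     / (p%:R ^+ (k - 1) * (p%:R - 1))).

Definition sumT2 (p n : nat) (m lam : nat -> nat) : rat :=
  \sum_(1 <= i < n) \sum_(m i <= k < m i.+1)
    (\prod_(1 <= j < i) p%:R ^+ (m j * lam j)) *
    p%:R ^+ ((m i - 1) * lam i) *
    ((p%:R ^+ (k * (psum lam n - psum lam i))
      - p%:R ^+ ((k - 1) * (psum lam n - psum lam i)))
     / (p%:R ^+ (k - 1) * (p%:R - 1))).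

Definition sumT3 (p n : nat) (m lam : nat -> nat) : rat :=
  \sum_(1 <= i < n) \sum_((m i).+1 <= k < m i.+1)
    (\prod_(1 <= j < i) p%:R ^+ (m j * lam j)) *
    (p%:R ^+ (m i * lam i) - p%:R ^+ ((m i - 1) * lam i)) *
    p%:R ^+ ((k - 1) * lam i.+1) *
    ((p%:R ^+ (k * (psum lam n - psum lam i.+1))
      - p%:R ^+ ((k - 1) * (psum lam n - psum lam i.+1)))
     / (p%:R ^+ (k - 1) * (p%:R - 1))).

(* Main.v *)
Require Import Defs.
From mathcomp Require Import all_boot all_order all_algebra all_fingroup all_solvable.
From mathcomp Require Import zify ring.

Set Implicit Arguments.
Unset Strict Implicit.
Unset Printing Implicit Defensive.

Import GRing.Theory.

(** A homomorphism from the cyclic group generated by h to G is the choice of an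
    image y with p ^ k y = 0, where p ^ k is the order of h, so the subgroup lies
    in X(G) exactly when some such y is not F h for any endomorphism F.  Write
    p ^ (o_s) for the order of the coordinate of h in the summand Z(p ^ mu_s), so
    that k is the maximum of the o_s.  The coordinate of F h in the summand t is a
    sum of images of the coordinates of h, and the s-th one can be sent to any
    element of order at most p ^ c, for c >= 1, if and only if
    c + (mu_s - mu_t) <= o_s, with truncated subtraction.  The coordinates of y that have to be reached in the
    summand t are those of order at most p ^ c for c = min (k, mu_t).  Hence
    (lemma XsetP) the subgroup is in X(G) if and only if there is a t with
      o_s < min (k, mu_t) + (mu_s - mu_t)   for all s.
    For sufficiency, this inequality says that p ^ (c - 1) h is a multiple
    p ^ (mu_t) g, which forces p ^ (c - 1) F h to vanish in the summand t; an
    element y of order p ^ c supported there is therefore never reached.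

    So membership depends on the exponent vector (o_s) alone, and so does the
    relation sim (lemma sim_cycle).  The number of classes is the number of
    vectors o satisfying the criterion; the number of subgroups is the number of
    such elements h, each counted with weight 1 / phi(p ^ k) since a cyclic group
    of order p ^ k has phi(p ^ k) generators (lemma card_Xset).  Both are sums
      sum_o g(max o) * prod_s w_s(o_s),
    with w = 1 and g = 1 in the first case, and in the second case w_s(j) the
    number of elements of order p ^ j in Z(p ^ mu_s) and g(k) = 1 / phi(p ^ k).
    In both cases W(b) = sum_(j < b) w_s(j) does not depend on s, being b and
    p ^ (b - 1) respectively, and this is all the evaluation needs.

    To evaluate (lemma weighted_sum), fix k = max o with m_i <= k < m_(i+1).  The
    best choices of t are in the blocks i and i+1, and the criterion becomes: all
    o_s in block i are less than m_i, or all o_s in blocks i and i+1 are less than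
    k.  The first alternative contributes the terms S_2 and T_2, the second one
    without the first S_3 and T_3, and for k < m_1, where only the second one
    exists, S_1 and T_1.  Each condition is a signed combination of conditions
    bounding every o_s by a constant depending on its block (lemma
    level_indicator), and the weighted sum over such a box is a product of powers
    of values of W (lemma sum_within). *)

(** * Orders of elements in cyclic p-groups *)

(** With vp x the valuation of x, the order of x is p to this power. *)
Definition oexp (p r : nat) (x : 'Z_(p ^ r)) : nat := r - vp p r x.

Arguments oexp p r x : clear implicits.

Lemma expn_gt1 p r : prime p -> 0 < r -> 1 < p ^ r.
Proof. by move=> pp r0; rewrite -(exp1n r) ltn_exp2r // prime_gt1. Qed.

Lemma ltn_Zexp p r (x : 'Z_(p ^ r)) : prime p -> 0 < r -> x < p ^ r.
Proof. by move=> pp r0; apply: leq_trans (ltn_ord x) _; rewrite Zp_cast ?expn_gt1. Qed.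

Lemma val_Zmuln p r (x : 'Z_(p ^ r)) a :
  prime p -> 0 < r -> (x *+ a)%R = (x * a) %% p ^ r :> nat.
Proof.
by move=> pp r0; rewrite Zp_mulrn /=; congr (_ %% _); rewrite Zp_cast ?expn_gt1.
Qed.

Lemma val_inZp p r a :
  prime p -> 0 < r -> (inZp a : 'Z_(p ^ r)) = a %% p ^ r :> nat.
Proof. by move=> pp r0; rewrite /=; congr (_ %% _); rewrite Zp_cast ?expn_gt1. Qed.

Lemma eq_Zmuln p r (x y : 'Z_(p ^ r)) a b :
  prime p -> 0 < r -> (x *+ a == y *+ b)%R = (x * a == y * b %[mod p ^ r]).
Proof. by move=> pp r0; rewrite -val_eqE /= !val_Zmuln. Qed.

Lemma oexp_le p r x : oexp p r x <= r.
Proof. exact: leq_subr. Qed.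

Lemma vp_le p r x : prime p -> 0 < r -> vp p r x <= r.
Proof.
move=> pp r0; rewrite /vp; case: ifP => // /negbT x0.
have xpos : 0 < x by rewrite lt0n.
have := ltn_Zexp x pp r0; have := pfactor_dvdnn p x => /(dvdn_leq xpos) h1 h2.
by have := leq_ltn_trans h1 h2; rewrite ltn_exp2l ?prime_gt1 // => /ltnW.
Qed.

Lemma leq_vp p r x j :
  prime p -> 0 < r -> j <= r -> (j <= vp p r x) = (p ^ j %| x).
Proof.
move=> pp r0 jr; rewrite /vp; case: eqP => [->|/eqP x0]; first by rewrite jr dvdn0.
by rewrite pfactor_dvdn // lt0n.
Qed.

Lemma oexp_leq p r (x : 'Z_(p ^ r)) a : prime p -> 0 < r ->
  (oexp p r x <= a) = (x *+ (p ^ a) == 0)%R.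
Proof.
move=> pp r0; rewrite -val_eqE /= val_Zmuln // -/(dvdn _ _) /oexp leq_subLR.
case: (leqP r a) => ra.
  by rewrite (leq_trans ra) ?leq_addl // -(subnK ra) expnD mulnA dvdn_mull.
rewrite addnC -leq_subLR leq_vp ?leq_subr //.
rewrite [X in _ = (X %| _)](_ : _ = p ^ (r - a) * p ^ a).
  by rewrite dvdn_pmul2r // expn_gt0 prime_gt0.
by rewrite -expnD subnK // ltnW.
Qed.

Lemma oexp_inZp p r c : prime p -> 0 < r -> c <= r ->
  oexp p r (inZp (p ^ (r - c))) = c.
Proof.
move=> pp r0 cr.
have oa a : (oexp p r (inZp (p ^ (r - c))) <= a) = (c <= a).
  rewrite oexp_leq // -val_eqE /= val_Zmuln // val_inZp // modnMml.
  by rewrite -/(dvdn _ _) -expnD dvdn_Pexp2l ?prime_gt1 // -leq_subLR subKn.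
by apply/eqP; rewrite eqn_leq oa leqnn -oa leqnn.
Qed.

(** Multiplication by p ^ a lowers the exponent of the order by a, and the
    multiples of p ^ b are the elements of order at most p ^ (r - b). *)
Lemma Zmuln_divisible p r (x : 'Z_(p ^ r)) a b : prime p -> 0 < r ->
  oexp p r x <= a + (r - b) -> exists g : 'Z_(p ^ r), (x *+ (p ^ a) = g *+ (p ^ b))%R.
Proof.
move=> pp r0 ox; case: (leqP b a) => ba.
  by exists (x *+ (p ^ (a - b)))%R; rewrite -mulrnA -expnD subnK.
case: (leqP b r) => br; last first.
  exists 0%R; rewrite mul0rn; apply/eqP; rewrite -oexp_leq //.
  by move: ox; rewrite (eqP (ltnW br : r - b == 0)) addn0.
have : p ^ (b - a) %| x.
  rewrite -leq_vp //; last exact: leq_trans (leq_subr _ _) br.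
  have := vp_le x pp r0; move: ox br ba; rewrite /oexp; lia.
case/dvdnP=> q xq; exists (inZp q); apply/eqP; rewrite eq_Zmuln // xq.
by rewrite val_inZp // -mulnA -expnD subnK 1?ltnW // modnMml.
Qed.

(** The images of a generator of Z(p ^ r1) are the multiples of p ^ (r2 - r1);
    so if x has valuation v, it can be sent to any multiple of
    p ^ (v + (r2 - r1)), which is what the inequality says of y. *)
Lemma Zp_hom p r1 r2 (x : 'Z_(p ^ r1)) (y : 'Z_(p ^ r2)) :
    prime p -> 0 < r1 -> 0 < r2 -> oexp p r2 y + (r1 - r2) <= oexp p r1 x ->
  exists2 phi : 'Z_(p ^ r1) -> 'Z_(p ^ r2),
    {morph phi : u v / (u + v)%R} & phi x = y.
Proof.
move=> pp r1p r2p oyx.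
have [y0 | ny0] := eqVneq y 0%R.
  by exists (fun=> 0%R) => // u v; rewrite addr0.
have nx0 : x != 0%R.
  apply: contra_neq ny0 => x0; apply/eqP; rewrite -[y]mulr1n -[1]/(p ^ 0).
  rewrite -oexp_leq //; move: oyx; rewrite {2}/oexp /vp x0 eqxx subnn.
  by case: (oexp _ _ y).
have xpos : 0 < x by rewrite lt0n.
set v := vp p r1 x; have vle : v <= r1 := vp_le x pp r1p.
have [w xw cpw] : exists2 w, x = w * p ^ v :> nat & coprime p w.
  have -> : v = logn p x by rewrite /v /vp (negPf nx0).
  by have [w ? ?] := pfactor_coprime pp xpos; exists w.
(* u inverts the unit part w of x modulo p ^ r2 *)
have [u uw] : exists u, w * u = 1 %[mod p ^ r2].
  have wp : 0 < w by move: xpos; rewrite xw muln_gt0 => /andP[].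
  have cp : coprime w (p ^ r2) by rewrite coprimeXr // coprime_sym.
  have [a b ab _] := egcdnP (p ^ r2) wp.
  exists a; rewrite mulnC ab (eqP cp) modnMDl //.
have [y' yy'] : exists y', y = y' * p ^ (v + (r2 - r1)) :> nat.
  apply/dvdnP; rewrite -leq_vp //; move: oyx (vp_le y pp r2p) vle;
    rewrite /oexp -/v; lia.
(* q is the image of 1, and must satisfy q x = y = y' p ^ (v + (r2 - r1)) *)
pose q : 'Z_(p ^ r2) := inZp (y' * (u * p ^ (r2 - r1))).
have qp : (q *+ (p ^ r1) = 0)%R.
  apply: val_inj; rewrite /= val_Zmuln // val_inZp // modnMml.
  apply/eqP; rewrite -/(dvdn _ _) -!mulnA -expnD; do 2 apply: dvdn_mull.
  by apply: dvdn_exp2l; lia.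
exists (fun z => q *+ z)%R => [z z' | ].
  rewrite -mulrnDr; have -> : (z + z')%R = (z + z') %% p ^ r1 :> nat.
    by rewrite /=; congr (_ %% _); rewrite Zp_cast ?expn_gt1.
  by rewrite [in RHS](divn_eq (z + z') (p ^ r1)) mulrnDr mulnC mulrnA qp mul0rn add0r.
apply: val_inj; rewrite /= val_Zmuln // val_inZp // modnMml xw.
rewrite -[RHS](modn_small (ltn_Zexp y pp r2p)) yy'.
have -> : y' * (u * p ^ (r2 - r1)) * (w * p ^ v)
   = (w * u) * (y' * p ^ (v + (r2 - r1))) by rewrite expnD; lia.
by rewrite -modnMml uw modnMml mul1n.
Qed.

Lemma card_multiples N d e : 0 < d -> N = e * d ->
  #|[set x : 'I_N | d %| x]| = e.
Proof.
move=> d0 ->.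
have h (i : 'I_e) : i * d < e * d by rewrite ltn_pmul2r.
rewrite -[RHS]card_ord -(@card_imset _ _ (fun i => Ordinal (h i))); last first.
  by move=> i j /(congr1 val) /= /eqP; rewrite eqn_pmul2r // => /eqP /val_inj.
apply: eq_card => x; rewrite inE; apply/dvdnP/imsetP => [[q xq]|[i _ ->]].
  have qe : q < e by rewrite -(ltn_pmul2r d0) -xq.
  by exists (Ordinal qe) => //; apply: val_inj.
by exists i.
Qed.

Lemma card_oexp_lt p r b : prime p -> 0 < b <= r.+1 -> 0 < r ->
  #|[set x : 'Z_(p ^ r) | oexp p r x < b]| = p ^ b.-1.
Proof.
move=> pp /andP[b0 br] r0.
have E : (Zp_trunc (p ^ r)).+2 = p ^ b.-1 * p ^ (r - b.-1).
  by rewrite Zp_cast ?expn_gt1 // -expnD subnKC // -ltnS prednK.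
have d0 : 0 < p ^ (r - b.-1) by rewrite expn_gt0 prime_gt0.
rewrite -(card_multiples d0 E); apply: eq_card => x; rewrite !inE.
rewrite -leq_vp ?leq_subr // /oexp; have := vp_le x pp r0; lia.
Qed.


(** * Exponent vectors and their weighted sums *)

Section ExponentVectors.

Variables (n : nat) (m lam : nat -> nat).
Hypothesis m_gt0 : forall i, 0 < i <= n -> 0 < m i.

(** The positions of the cyclic summands, listed without reference to the two
    levels of the direct sum. *)
Definition idx : finType := {i : 'I_n & 'I_(lam i.+1)}%type.

Definition mu (s : idx) : nat := m (tag s).+1.

Lemma mu_gt0 s : 0 < mu s.
Proof. by apply: m_gt0; rewrite ltn_ord. Qed.

Definition mu_max : nat := \max_s mu s.

Definition exptype : finType := {ffun idx -> 'I_mu_max.+1}.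

Definition expmax (o : exptype) : nat := \max_s o s.

Definition admissible (o : exptype) : bool := [forall s, o s <= mu s].

(** The criterion for the cyclic subgroup generated by an element with exponent
    vector o to belong to X(G); see XsetP. *)
Definition nonextendable (o : exptype) : bool :=
  [exists t, forall s, o s < minn (expmax o) (mu t) + (mu s - mu t)].

Local Open Scope ring_scope.

Hypothesis n_gt0 : (0 < n)%N.
Hypothesis m_incr : forall i, (0 < i)%N -> (i < n)%N -> (m i < m i.+1)%N.
Hypothesis lam_gt0 : forall i, (0 < i)%N -> (i <= n)%N -> (0 < lam i)%N.

Definition block (s : idx) : nat := (tag s).+1.

Lemma block_le s : (block s <= n)%N.
Proof. exact: ltn_ord. Qed.

Lemma block_surj i : (0 < i <= n)%N -> exists s, block s = i.
Proof.
case: i => // i; rewrite ltnS /= => i_n.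
have l0 : (0 < lam i.+1)%N by apply: lam_gt0.
by exists (Tagged (fun i : 'I_n => 'I_(lam i.+1)) (i := Ordinal i_n) (Ordinal l0)).
Qed.

Lemma m_mono i j : (0 < i)%N -> (i < j)%N -> (j <= n)%N -> (m i < m j)%N.
Proof.
move=> i0; elim: j => // j IHj; rewrite ltnS leq_eqVlt => /predU1P[<-|ij] jn.
  exact: m_incr.
by apply: ltn_trans (IHj ij (ltnW jn)) _; apply: m_incr => //; apply: leq_trans ij.
Qed.

Lemma m_mono_leq i j : (0 < i)%N -> (i <= j)%N -> (j <= n)%N -> (m i <= m j)%N.
Proof.
by move=> i0; rewrite leq_eqVlt => /predU1P[-> //|ij jn]; apply/ltnW/m_mono.
Qed.

Lemma expmax_lt o c : (0 < c)%N -> (expmax o < c)%N = [forall s, o s < c]%N.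
Proof.
by case: c => // c _; rewrite ltnS; apply/bigmax_leqP/forallP => [h s|h s _];
  [exact: (h s isT) | exact: (h s)].
Qed.

Definition below (P : pred nat) (c : nat) (o : exptype) : bool :=
  [forall s, P (block s) ==> (o s < c)%N].

Lemma belowP (P : pred nat) c (o : exptype) :
  reflect (forall s, P (block s) -> (o s < c)%N) (below P c o).
Proof. exact: forall_inP. Qed.

Lemma below_le (P : pred nat) c d o : (c <= d)%N -> below P c o -> below P d o.
Proof. by move=> cd /belowP h; apply/belowP => s Ps; apply: leq_trans (h s Ps) cd. Qed.

Definition within (b : nat -> nat) (o : exptype) : bool :=
  [forall s, o s < b (block s)]%N.

(** The bounds on the entries of o that occur at level i: none in the blocks
    before i, where entries are at most m_j anyway, o_s < x in block i, o_s < y in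
    block i+1, and o_s < c in the later ones. *)
Definition level_bound (i x y c j : nat) : nat :=
  if (j < i)%N then (m j).+1 else
  if j == i then x else if j == i.+1 then y else c.

Lemma admissible_le o s : admissible o -> (o s <= m (block s))%N.
Proof. by move/forallP. Qed.

Lemma within_level_bound i x y c o : admissible o ->
  within (level_bound i x y c) o =
  [&& below (pred1 i) x o, below (pred1 i.+1) y o & below [pred j | i.+1 < j]%N c o].
Proof.
move=> oa; apply/forallP/and3P => [h|[/belowP hx /belowP hy /belowP hc] s].
  split; apply/belowP => s /= ps; have := h s; rewrite /level_bound.
  - by rewrite (eqP ps) ltnn eqxx.
  - by rewrite (eqP ps) [(i.+1 < i)%N]ltnNge leqnSn /= gtn_eqF ?eqxx.
  by rewrite [(block s < i)%N]ltnNge (ltnW (ltnW ps)) /= !gtn_eqF // ltnW.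
rewrite /level_bound; case: (ltngtP (block s) i) => [_ | ij | ij].
- by rewrite ltnS admissible_le.
- case: eqP => [e | /eqP ne]; first by apply: hy; rewrite /= e.
  by apply: hc; rewrite /= ltn_neqAle eq_sym ne.
by apply: hx; rewrite /= ij.
Qed.

(** Level i consists of the k with m_i <= k < m_(i+1); level 0 of those below m_1,
    the value of m at 0 being arbitrary. *)
Section Level.

Variables (i k : nat) (o : exptype).
Hypotheses (i_lt : (i < n)%N) (k_gt0 : (0 < k)%N).
Hypotheses (mi_le : (0 < i)%N -> (m i <= k)%N) (k_lt : (k < m i.+1)%N).
Hypothesis oa : admissible o.

Lemma block_cases s :
  [\/ [/\ (block s < i)%N, (0 < i)%N & (m (block s) < m i)%N],
      [/\ block s = i, (0 < i)%N & m (block s) = m i],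
      block s = i.+1 /\ m (block s) = m i.+1
    | (i.+1 < block s)%N /\ (m i.+1 < m (block s))%N].
Proof.
case: (ltngtP (block s) i) => h.
- constructor 1; split=> //; first exact: leq_ltn_trans h.
  by apply: m_mono => //; apply: ltnW.
- move: h; rewrite leq_eqVlt => /predU1P[<- | h]; first by constructor 3.
  by constructor 4; split=> //; apply: m_mono => //; apply: block_le.
by constructor 2; split; rewrite -?h.
Qed.

Lemma level_expmax_ltS :
  (expmax o < k.+1)%N =
  below (pred1 i.+1) k.+1 o && below [pred j | i.+1 < j]%N k.+1 o.
Proof.
rewrite expmax_lt //; apply/forallP/andP => [h|[/belowP hy /belowP hc] s].
  by split; apply/belowP.
have := admissible_le s oa; case: (block_cases s) => [[? i0 ?]|[? i0 ?]|[e ?]|[e ?]].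
- by have := mi_le i0; lia.
- by have := mi_le i0; lia.
- by move=> _; apply: hy; rewrite /= e.
by move=> _; apply: hc.
Qed.

Lemma level_expmax_lt :
  (expmax o < k)%N =
  [&& below (pred1 i) k o, below (pred1 i.+1) k o & below [pred j | i.+1 < j]%N k o].
Proof.
rewrite expmax_lt //; apply/forallP/and3P => [h|[/belowP hx /belowP hy /belowP hc] s].
  by split; apply/belowP.
have := admissible_le s oa; case: (block_cases s) => [[? i0 ?]|[e i0 ?]|[e ?]|[e ?]].
- by have := mi_le i0; lia.
- by move=> _; apply: hx; rewrite /= e.
- by move=> _; apply: hy; rewrite /= e.
by move=> _; apply: hc.
Qed.

(** The inequality of the criterion is weakest, among the t with mu_t <= k, for
    the largest such mu_t, namely m_i; among the others, for the smallest mu_t,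
    namely m_(i+1).  In the first case it amounts to o_s < mu_s for mu_s >= m_i,
    where only block i matters because o_s <= k; in the second case to o_s < k
    for mu_s <= m_(i+1), where the blocks before i are irrelevant because
    m_j < m_i <= k. *)
Lemma nonextendable_level : expmax o = k ->
  nonextendable o = (0 < i)%N && below (pred1 i) (m i) o
                    || below (pred1 i) k o && below (pred1 i.+1) k o.
Proof.
move=> ok; have o_le s : (o s <= k)%N.
  by rewrite -ok; apply: (leq_bigmax s).
rewrite /nonextendable ok; apply/existsP/idP => [[t /forallP ht]|].
  have [ti | ti] := leqP (block t) i.
    have i0 : (0 < i)%N by apply: leq_trans ti.
    have mt : (m (block t) <= m i)%N by apply: m_mono_leq => //; apply: ltnW.
    rewrite i0; apply/orP; left; apply/belowP => s /eqP si.
    have := ht s; have := mi_le i0; rewrite /mu -/(block t) -/(block s) si; lia.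
  have mt : (m i.+1 <= m (block t))%N by apply: m_mono_leq => //; apply: block_le.
  have H s : (m (block s) <= m i.+1)%N -> (o s < k)%N.
    by have := ht s; rewrite /mu -/(block t) -/(block s); lia.
  apply/orP; right; apply/andP; split; apply/belowP => s /eqP si; apply: H.
    by rewrite si ltnW // m_incr // -si.
  by rewrite si.
case/orP=> [/andP[i0 /belowP hx]|/andP[/belowP hx /belowP hy]].
  have [t ti] : exists t, block t = i by apply: block_surj; rewrite i0 ltnW.
  exists t; apply/forallP => s; rewrite /mu -/(block t) -/(block s) ti.
  have := admissible_le s oa; have := o_le s; have := mi_le i0.
  case: (block_cases s) => [[? _ ?]|[e _ ?]|[e ?]|[e ?]]; first by lia.
  - by have := hx s; rewrite /= e eqxx => /(_ isT); lia.
  - by lia.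
  by lia.
have [t ti] : exists t, block t = i.+1 by apply: block_surj.
exists t; apply/forallP => s; rewrite /mu -/(block t) -/(block s) ti.
have := admissible_le s oa; have := o_le s.
case: (block_cases s) => [[? i0 ?]|[e _ ?]|[e ?]|[e ?]].
- by have := mi_le i0; lia.
- by have := hx s; rewrite /= e eqxx => /(_ isT); lia.
- by have := hy s; rewrite /= e eqxx => /(_ isT); lia.
by lia.
Qed.

(** The two alternatives of the criterion are made disjoint by removing the first
    from the second: this is the last, subtracted, difference.  In each pair of
    terms, subtracting the box with bound k turns max o <= k into max o = k.  If
    k = m_i the second alternative implies the first, whence the factor in
    front. *)
Lemma level_indicator :
  (nonextendable o && (expmax o == k))%:R =
    (0 < i)%N%:R * ((within (level_bound i (m i) k.+1 k.+1) o)%:R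
                  - (within (level_bound i (m i) k k) o)%:R)
    + ((0 < i)%N ==> (m i < k)%N)%:R *
       ((within (level_bound i (m i).+1 k k.+1) o)%:R
        - (within (level_bound i (m i).+1 k k) o)%:R
        - (0 < i)%N%:R * ((within (level_bound i (m i) k k.+1) o)%:R
                        - (within (level_bound i (m i) k k) o)%:R)) :> rat.
Proof.
have -> : nonextendable o && (expmax o == k) =
    [&& (0 < i)%N && below (pred1 i) (m i) o
                    || below (pred1 i) k o && below (pred1 i.+1) k o,
        (expmax o < k.+1)%N & ~~ (expmax o < k)%N].
  rewrite -leqNgt ltnS -eqn_leq; case: eqP => [e|]; last by rewrite !andbF.
  by rewrite nonextendable_level.
rewrite level_expmax_ltS level_expmax_lt !within_level_bound //.
have X1 : below (pred1 i) (m i).+1 o.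
  by apply/belowP => s /eqP <-; rewrite ltnS admissible_le.
have Xk : below (pred1 i) k o = ((0 < i)%N ==> (m i < k)%N) || below (pred1 i) (m i) o.
  have [i0 | i_pos] := posnP i.
    by rewrite i0 /=; apply/belowP => s /eqP.
  have := mi_le i_pos; rewrite leq_eqVlt => /predU1P[<-|h]; first by rewrite ltnn.
  by rewrite h /=; apply: below_le X1.
have Yk := @below_le (pred1 i.+1) k k.+1 o (leqnSn k).
have Ck := @below_le [pred j | i.+1 < j]%N k k.+1 o (leqnSn k).
(* the identity now holds for all truth values of the atoms that respect Yk, Ck *)
rewrite Xk X1; move: Yk Ck.
move: (below _ k o) (below _ k.+1 o) (below _ k o) (below _ k.+1 o).
move: (below _ (m i) o) (0 < i)%N (m i < k)%N.
do 3 case; do 4 case; move=> hy hc;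
  by [have := hy isT | have := hc isT | rewrite /=; ring].
Qed.

End Level.

(** The cumulative weights W are the same in every summand; this covers both
    counting exponent vectors and counting elements. *)
Section WeightedSum.

Variables (w : forall s : idx, nat -> rat) (W : nat -> rat).
Hypothesis sum_w : forall s b, (0 < b <= (mu s).+1)%N ->
  \sum_(0 <= j < b) w s j = W b.

(** Distributivity of products over sums turns a sum over a box into a product. *)
Lemma sum_within b :
    (forall i, (0 < i <= n)%N -> (0 < b i <= (m i).+1)%N) ->
  \sum_(o | within b o) \prod_s w s (o s) = \prod_(1 <= i < n.+1) W (b i) ^+ lam i.
Proof.
move=> b_le; rewrite big_mkcond /=.
transitivity (\sum_(o : exptype) \prod_s (if (o s < b (block s))%N then w s (o s) else 0)).
  apply: eq_bigr => o _; case: ifP => [/forallP h | /negbT].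
    by apply: eq_bigr => s _; rewrite h.
  rewrite negb_forall => /existsP[s /negPf hs].
  by rewrite (bigD1 s) //= hs mul0r.
rewrite -(bigA_distr_bigA (fun s (j : 'I_mu_max.+1) =>
  if (j < b (block s))%N then w s j else 0)).
transitivity (\prod_s W (b (block s))).
  apply: eq_bigr => s _; rewrite -big_mkcond /= -(sum_w (b_le (block s) (ltn_ord _))).
  rewrite big_mkord -(big_ord_widen _ (w s)) //.
  have /andP[_ h] := b_le (block s) (ltn_ord _); apply: leq_trans h _.
  by rewrite ltnS; apply: (leq_bigmax s).
rewrite -(sig_big_dep xpredT (fun (i : 'I_n) (_ : 'I_(lam i.+1)) => true)
  (fun i _ => W (b i.+1))) /= big_add1 big_mkord.
by apply: eq_bigr => i _; rewrite prodr_const card_ord.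
Qed.

Lemma prod_level_bound i x y c : (0 < i < n)%N ->
  \prod_(1 <= j < n.+1) W (level_bound i x y c j) ^+ lam j =
  (\prod_(1 <= j < i) W (m j).+1 ^+ lam j) * W x ^+ lam i * W y ^+ lam i.+1
   * W c ^+ (psum lam n - psum lam i.+1).
Proof.
case/andP=> i0 ilt; rewrite (@big_cat_nat _ _ _ i 1 n.+1) //=; last exact/ltnW/ltnW.
rewrite (@big_ltn _ _ _ i n.+1) ?ltnS 1?ltnW // (@big_ltn _ _ _ i.+1 n.+1) //.
rewrite !mulrA; congr (_ * _ * _ * _).
- by apply: eq_big_nat => j /andP[_ ji]; rewrite /level_bound ji.
- by rewrite /level_bound ltnn eqxx.
- by rewrite /level_bound ltnNge leqnSn /= gtn_eqF // eqxx.
rewrite /psum (@big_cat_nat _ _ _ i.+2 1 n.+1) //= addnC addnK expr_sum.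
apply: eq_big_nat => j /andP[ij _].
by rewrite /level_bound ltnNge (ltnW (ltnW ij)) /= !gtn_eqF // ltnW.
Qed.

Lemma psumS i : psum lam i.+1 = (psum lam i + lam i.+1)%N.
Proof. by rewrite /psum big_nat_recr. Qed.

Lemma psum_le i j : (i <= j)%N -> (psum lam i <= psum lam j)%N.
Proof.
move=> /subnKC <-; elim: (j - i)%N => [|d IHd]; rewrite ?addn0 // addnS psumS.
by apply: leq_trans IHd _; rewrite leq_addr.
Qed.

Lemma prod_level_bound_merge i x c : (0 < i < n)%N ->
  \prod_(1 <= j < n.+1) W (level_bound i x c c j) ^+ lam j =
  (\prod_(1 <= j < i) W (m j).+1 ^+ lam j) * W x ^+ lam i
   * W c ^+ (psum lam n - psum lam i).
Proof.
move=> i_lt; rewrite prod_level_bound // -mulrA -exprD; congr (_ * _ ^+ _).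
case/andP: i_lt => i0 ilt; have := psum_le ilt; rewrite psumS.
by lia.
Qed.

Lemma prod_level_bound0 x y c :
  \prod_(1 <= j < n.+1) W (level_bound 0 x y c j) ^+ lam j =
  W y ^+ lam 1%N * W c ^+ (psum lam n - lam 1%N).
Proof.
rewrite big_ltn // [X in X * _](_ : _ = W y ^+ lam 1%N) //; congr (_ * _).
rewrite /psum (@big_ltn _ _ _ 1 n.+1) // addnC addnK expr_sum.
by apply: eq_big_nat => -[|[|j]] // _.
Qed.

Definition weight (o : exptype) : rat := \prod_s w s (o s).

Definition level_sum (k : nat) : rat :=
  \sum_(o | admissible o && (nonextendable o && (expmax o == k))) weight o.

Lemma sum_mulr_indicator (P : pred exptype) :
  \sum_(o | admissible o && P o) weight o = \sum_(o | admissible o) (P o)%:R * weight o.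
Proof.
by rewrite big_mkcondr; apply: eq_bigr => o _; case: (P o); rewrite ?mul1r ?mul0r.
Qed.

Lemma sum_within_indicator b :
    (forall i, (0 < i <= n)%N -> (0 < b i <= (m i).+1)%N) ->
  \sum_(o | admissible o) (within b o)%:R * weight o
  = \prod_(1 <= i < n.+1) W (b i) ^+ lam i.
Proof.
move=> b_le; rewrite -sum_mulr_indicator -sum_within //; apply: eq_bigl => o.
rewrite andb_idl // => /forallP h; apply/forallP => s; rewrite -ltnS.
by apply: leq_trans (h s) _; have /andP[] := b_le (block s) (ltn_ord _).
Qed.

Lemma level_bound_range i x y c : (i < n)%N ->
    ((0 < i)%N -> 0 < x <= (m i).+1)%N -> (0 < y <= (m i.+1).+1)%N ->
    (0 < c <= (m i.+1).+1)%N ->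
  forall j, (0 < j <= n)%N -> (0 < level_bound i x y c j <= (m j).+1)%N.
Proof.
move=> ilt hx hy hc j /andP[j0 jn]; rewrite /level_bound.
case: (ltngtP j i) => [_|ij|ji] /=; first by rewrite leqnn.
  case: (j =P i.+1) => [-> // | /eqP ne].
  have : (m i.+1 < m j)%N by apply: m_mono => //; rewrite ltn_neqAle eq_sym ne.
  by move: hc; lia.
by rewrite ji; apply: hx; rewrite -ji.
Qed.

Lemma level_sum_first k : (0 < k < m 1)%N ->
  level_sum k = W k ^+ lam 1%N *
    (W k.+1 ^+ (psum lam n - lam 1%N) - W k ^+ (psum lam n - lam 1%N)).
Proof.
case/andP=> k0 km; rewrite /level_sum sum_mulr_indicator.
transitivity (\sum_(o | admissible o) ((within (level_bound 0 (m 0).+1 k k.+1) o)%:R * weight o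
     - (within (level_bound 0 (m 0).+1 k k) o)%:R * weight o)).
  apply: eq_bigr => o oa; rewrite (level_indicator (i := 0)) //=.
  by rewrite !mul0r add0r subr0 mul1r mulrBl.
rewrite sumrB !sum_within_indicator; try (apply: level_bound_range => //; lia).
by rewrite !prod_level_bound0 mulrBr.
Qed.

Lemma level_sum_middle i k : (0 < i < n)%N -> (m i <= k < m i.+1)%N ->
  level_sum k =
    W (m i) ^+ lam i * (\prod_(1 <= j < i) W (m j).+1 ^+ lam j) *
     (W k.+1 ^+ (psum lam n - psum lam i) - W k ^+ (psum lam n - psum lam i))
    + (m i < k)%N%:R *
      (W k ^+ lam i.+1 * (W (m i).+1 ^+ lam i - W (m i) ^+ lam i) *
       (\prod_(1 <= j < i) W (m j).+1 ^+ lam j) *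
       (W k.+1 ^+ (psum lam n - psum lam i.+1) - W k ^+ (psum lam n - psum lam i.+1))).
Proof.
move=> i_lt /andP[mk km]; rewrite /level_sum sum_mulr_indicator.
have [i0 iln] := andP i_lt.
have mi0 : (0 < m i)%N by apply: m_gt0; rewrite i0 ltnW.
have k0 : (0 < k)%N by apply: leq_trans mk.
pose R b := \sum_(o | admissible o) (within b o)%:R * weight o.
transitivity (R (level_bound i (m i) k.+1 k.+1) - R (level_bound i (m i) k k) +
   (m i < k)%N%:R * (R (level_bound i (m i).+1 k k.+1) - R (level_bound i (m i).+1 k k)
      - (R (level_bound i (m i) k k.+1) - R (level_bound i (m i) k k)))).
  rewrite /R -!sumrB mulr_sumr -big_split; apply: eq_bigr => o oa /=.
  by rewrite (level_indicator (i := i)) // i0 /=; ring.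
rewrite /R !sum_within_indicator; try (apply: level_bound_range => //; lia).
congr (_ + _ * _); first by rewrite !prod_level_bound_merge //; ring.
by rewrite !prod_level_bound //; ring.
Qed.

Lemma nonextendable_range o : nonextendable o -> (0 < expmax o < m n)%N.
Proof.
case/existsP=> t /forallP ht.
have mle s : (mu s <= m n)%N by apply: m_mono_leq => //; apply: block_le.
apply/andP; split; first by have := ht t; lia.
rewrite expmax_lt; last by apply: m_gt0; rewrite n_gt0 leqnn.
by apply/forallP => s; have := ht s; have := mle s; have := mle t; lia.
Qed.

Lemma sum_split_levels (f : nat -> rat) q : (q < n)%N ->
  \sum_(1 <= k < m q.+1) f k =
  \sum_(1 <= k < m 1) f k + \sum_(1 <= i < q.+1) \sum_(m i <= k < m i.+1) f k.
Proof.
elim: q => [|q IHq] qn; first by rewrite (@big_geq _ _ _ 1 1) // addr0.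
rewrite big_nat_recr //= addrA -IHq ?(ltnW qn) // -big_cat_nat //.
  by apply: m_gt0; rewrite /= ltnW.
by apply/ltnW/m_incr.
Qed.

(** If o satisfies the criterion, its maximum lies between 1 and m_n - 1, so that it
    falls into exactly one level. *)
Lemma weighted_sum (g : nat -> rat) :
  \sum_(o | admissible o && nonextendable o) g (expmax o) * weight o =
  (\sum_(1 <= k < m 1%N) g k *
    (W k ^+ lam 1%N *
     (W k.+1 ^+ (psum lam n - lam 1%N) - W k ^+ (psum lam n - lam 1%N))))
  + (\sum_(1 <= i < n) \sum_(m i <= k < m i.+1) g k *
      (W (m i) ^+ lam i * (\prod_(1 <= j < i) W (m j).+1 ^+ lam j) *
       (W k.+1 ^+ (psum lam n - psum lam i) - W k ^+ (psum lam n - psum lam i))))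
  + (\sum_(1 <= i < n) \sum_((m i).+1 <= k < m i.+1) g k *
      (W k ^+ lam i.+1 * (W (m i).+1 ^+ lam i - W (m i) ^+ lam i) *
       (\prod_(1 <= j < i) W (m j).+1 ^+ lam j) *
       (W k.+1 ^+ (psum lam n - psum lam i.+1)
        - W k ^+ (psum lam n - psum lam i.+1)))).
Proof.
transitivity (\sum_(1 <= k < m n) g k * level_sum k).
  transitivity (\sum_(o | admissible o && nonextendable o)
     \sum_(1 <= k < m n | k == expmax o) g k * weight o).
    apply: eq_bigr => o /andP[_ /nonextendable_range].
    by rewrite big_nat1_eq => ->.
  rewrite (exchange_big_dep xpredT) //=; apply: eq_bigr => k _.
  rewrite /level_sum mulr_sumr; apply: eq_bigl => o.
  by rewrite andbA eq_sym.
have -> : n = n.-1.+1 by rewrite prednK.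
rewrite sum_split_levels ?prednK // -addrA; congr (_ + _).
  by apply: eq_big_nat => k hk; rewrite level_sum_first.
rewrite -big_split /=; apply: eq_big_nat => i hi.
have /andP[i0 iln] := hi.
have := m_incr i0 iln; set S3 := (X in _ -> _ = _ + X) => mi_lt.
rewrite (eq_big_nat _ _ (fun k hk => congr1 (fun x => g k * x) (level_sum_middle hi hk))).
under eq_bigr do rewrite mulrDr.
rewrite big_split /=; congr (_ + _).
(* the term k = m_i of the third sum vanishes *)
rewrite big_ltn // ltnn mul0r mulr0 add0r.
by apply: eq_big_nat => k /andP[-> _]; rewrite mul1r.
Qed.

End WeightedSum.

End ExponentVectors.

(** * Cyclic subgroups with a non-extendable homomorphism *)

Section CyclicSubgroups.

Variables (gT : finGroupType) (h : gT).

(** A hom from <[h]> is the choice of an image y of h with y ^+ #[h] = 1, and it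
    agrees with an endomorphism F on <[h]> as soon as F h = y. *)
Lemma cycle_in_XsetP :
  reflect (exists2 y : gT, (y ^+ #[h] = 1)%g &
             forall F : gT -> gT, {morph F : u v / (u * v)%g} -> F h <> y)
          (<[h]>%G \in Xset [set: gT]).
Proof.
rewrite inE subsetT cycle_cyclic /=; apply: (iffP existsP).
  case=> f /andP[/andP[/morphicP fM _] /forallP noF].
  have f1 : f 1%g = 1%g.
    by apply: (mulgI (f 1%g)); rewrite -fM ?mulg1 ?group1.
  have fX a : f (h ^+ a)%g = (f h ^+ a)%g.
    by elim: a => [|a IHa]; rewrite ?expg0 // !expgS fM ?IHa ?mem_cycle ?cycle_id.
  exists (f h); first by rewrite -fX expg_order.
  move=> F FM Fh; have FX a : F (h ^+ a)%g = (F h ^+ a)%g.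
    elim: a => [|a IHa]; last by rewrite !expgS FM IHa.
    by apply: (mulgI (F 1%g)); rewrite -FM !mulg1.
  have /implyP := noF (finfun F); case/(_ _)/negP.
    by rewrite /is_hom subsetT andbT; apply/morphicP => u v _ _; rewrite !ffunE FM.
  by apply/forall_inP => x /cycleP[a ->]; rewrite ffunE FX fX Fh.
case=> y yh noF; have dyh : #[y]%g %| #[h]%g by rewrite order_dvdn yh.
exists (finfun (eltm dyh)); apply/andP; split.
  rewrite /is_hom subsetT andbT; apply/morphicP => _ _ /cycleP[a ->] /cycleP[b ->].
  by rewrite !ffunE -expgD !eltmE expgD.
apply/forallP => F; apply/implyP => /andP[/morphicP FM _].
apply/negP => /forall_inP/(_ h (cycle_id h))/eqP; rewrite ffunE eltm_id.
by apply: noF => u v; rewrite FM ?inE.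
Qed.

End CyclicSubgroups.

(** * The direct sum of cyclic groups in coordinates *)

Section Coordinates.

Variables (p n : nat) (m lam : nat -> nat).
Hypothesis p_prime : prime p.
Hypothesis m_gt0 : forall i, 0 < i <= n -> 0 < m i.

Local Notation G := (abgroup p n m lam).
Local Notation idx := (idx n lam).
Local Notation mu := (@mu n m lam).
Local Notation exptype := (exptype n m lam).
Local Notation mu_gt0 := (@mu_gt0 n m lam m_gt0).

Definition coord (h : G) (s : idx) : 'Z_(p ^ mu s) := h (tag s) (tagged s).

Definition of_coord (c : forall s : idx, 'Z_(p ^ mu s)) : G :=
  [ffun i : 'I_n => [ffun j : 'I_(lam i.+1) =>
     c (Tagged (fun i : 'I_n => 'I_(lam i.+1)) j)]].

Lemma of_coordK c s : coord (of_coord c) s = c s.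
Proof. by case: s => i j; rewrite /coord !ffunE. Qed.

Lemma coord_inj h h' : (forall s, coord h s = coord h' s) -> h = h'.
Proof.
move=> hh; apply/ffunP => i; apply/ffunP => j.
exact: (hh (Tagged (fun i : 'I_n => 'I_(lam i.+1)) j)).
Qed.

Lemma coordM h h' s : coord (h * h')%g s = (coord h s + coord h' s)%R.
Proof. exact: abgroup_mulE. Qed.

Lemma coord1 s : coord 1%g s = 0%R.
Proof. by apply: (addrI (coord 1%g s)); rewrite -coordM mulg1 addr0. Qed.

Lemma coordX h a s : coord (h ^+ a)%g s = (coord h s *+ a)%R.
Proof.
by elim: a => [|a IHa]; rewrite ?expg0 ?coord1 // expgS coordM IHa mulrS.
Qed.

Definition ordexp (h : G) (s : idx) : nat := oexp p (mu s) (coord h s).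

Lemma ordexp_le h s : ordexp h s <= mu s.
Proof. exact: oexp_le. Qed.

Lemma ordexpP h s a : (ordexp h s <= a) = (coord (h ^+ (p ^ a))%g s == 0%R).
Proof. by rewrite coordX /ordexp oexp_leq ?mu_gt0. Qed.

Definition maxexp (h : G) : nat := \max_s ordexp h s.

Lemma maxexpP h a : (maxexp h <= a) = (h ^+ (p ^ a) == 1)%g.
Proof.
apply/bigmax_leqP/eqP => [ha | ha s _].
  by apply: coord_inj => s; apply/eqP; rewrite coord1 -ordexpP ha.
by rewrite ordexpP ha coord1.
Qed.

Lemma order_maxexp h : #[h]%g = p ^ maxexp h.
Proof.
have: #[h]%g %| p ^ maxexp h by rewrite order_dvdn -maxexpP.
case/(dvdn_pfactor _ _ p_prime)=> a ha oh; rewrite oh; congr (_ ^ _).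
by apply/eqP; rewrite eqn_leq ha maxexpP -order_dvdn oh /=.
Qed.

(** If the inequality fails for every t, the index s violating it for t supplies
    a homomorphism Z(p ^ mu_s) -> Z(p ^ mu_t) sending the s-th coordinate of h to
    the t-th coordinate of y, and these assemble to an endomorphism sending h
    to y.  Conversely, if p ^ (c - 1) h = p ^ (mu_t) g, then F maps h to an
    element whose t-th coordinate is killed by p ^ (c - 1). *)
Lemma XsetP h :
  reflect (exists t, forall s, ordexp h s < minn (maxexp h) (mu t) + (mu s - mu t))
          (<[h]>%G \in Xset [set: G]).
Proof.
set k := maxexp h.
apply: (iffP (cycle_in_XsetP h)) => [[y yh noF]|[t bound]].
  have [/existsP[t /forallP ht]|] :=
    boolP [exists t, forall s, ordexp h s < minn k (mu t) + (mu s - mu t)].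
    by exists t.
  rewrite negb_exists => /forallP noT; exfalso.
  have phiP t : exists phi : {s : idx & {ffun 'Z_(p ^ mu s) -> 'Z_(p ^ mu t)}},
     [forall u, forall v, tagged phi (u + v)%R == (tagged phi u + tagged phi v)%R]
     && (tagged phi (coord h (tag phi)) == coord y t).
    have := noT t; rewrite negb_forall => /existsP[s]; rewrite -leqNgt => hs.
    have yt : ordexp y t <= minn k (mu t).
      rewrite leq_min ordexp_le andbT; apply: (leq_trans (leq_bigmax t)).
      by rewrite -/(maxexp y) maxexpP -order_maxexp yh.
    have := @Zp_hom p (mu s) (mu t) (coord h s) (coord y t) p_prime
              (mu_gt0 s) (mu_gt0 t).
    case; first by apply: leq_trans hs; rewrite leq_add2r.
    move=> phi phiM phix.
    exists (Tagged (fun s : idx => {ffun 'Z_(p ^ mu s) -> 'Z_(p ^ mu t)}) (finfun phi)).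
    rewrite /= ffunE phix eqxx andbT.
    by apply/forallP => u; apply/forallP => v; rewrite !ffunE phiM.
  pose phi t := xchoose (phiP t).
  have phiM t u v :
      (tagged (phi t) (u + v) = tagged (phi t) u + tagged (phi t) v)%R.
    by have /andP[/forallP/(_ u)/forallP/(_ v)/eqP] := xchooseP (phiP t).
  have phih t : tagged (phi t) (coord h (tag (phi t))) = coord y t.
    by have /andP[_ /eqP] := xchooseP (phiP t).
  apply: (noF (fun x => of_coord (fun t => tagged (phi t) (coord x (tag (phi t)))))).
    by move=> u v; apply: coord_inj => t; rewrite coordM !of_coordK coordM phiM.
  by apply: coord_inj => t; rewrite of_coordK phih.
set c := minn k (mu t) in bound.
have c_gt0 : 0 < c by have := bound t; rewrite subnn addn0; apply: leq_trans.
have [g hg] : exists g : G, (h ^+ (p ^ c.-1) = g ^+ (p ^ mu t))%g.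
  have gP s : exists g : 'Z_(p ^ mu s),
      (coord h s *+ (p ^ c.-1) == g *+ (p ^ mu t))%R.
    have [|g ->] := @Zmuln_divisible p (mu s) (coord h s) c.-1 (mu t) p_prime (mu_gt0 s).
      by rewrite -ltnS -addSn prednK //; apply: bound.
    by exists g.
  exists (of_coord (fun s => xchoose (gP s))); apply: coord_inj => s.
  by rewrite !coordX of_coordK; apply/eqP/(xchooseP (gP s)).
(* y has order p ^ c and is supported on the summand t *)
pose y : G := of_coord (fun s => if s == t then inZp (p ^ (mu t - c)) else 0)%R.
have yt a : (coord (y ^+ (p ^ a))%g t == 0%R) = (c <= a).
  by rewrite -ordexpP /ordexp of_coordK eqxx oexp_inZp ?mu_gt0 ?geq_minr.
exists y.
  apply: coord_inj => s; rewrite coord1 order_maxexp -/k.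
  have [-> | st] := eqVneq s t; first by apply/eqP; rewrite yt geq_minl.
  by rewrite coordX of_coordK (negPf st) mul0rn.
move=> F FM Fh; have FX x a : F (x ^+ a)%g = (F x ^+ a)%g.
  elim: a => [|a IHa]; last by rewrite !expgS FM IHa.
  by apply: (mulgI (F 1%g)); rewrite -FM !mulg1.
have: coord (y ^+ (p ^ c.-1))%g t = 0%R.
  by rewrite -Fh -FX hg FX; apply/eqP; rewrite -ordexpP ordexp_le.
by move/eqP; rewrite yt; case: (c) c_gt0 => // c' _; rewrite ltnn.
Qed.

(** * Counting classes and subgroups by exponent vectors *)

Lemma ordexp_cycle h h' s : h' \in <[h]>%g -> ordexp h' s <= ordexp h s.
Proof.
case/cycleP=> a ->; rewrite ordexpP -expgM mulnC expgM coordX.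
by have := leqnn (ordexp h s); rewrite ordexpP => /eqP ->; rewrite mul0rn.
Qed.

Lemma sim_cycle h h' :
  sim <[h]>%G <[h']>%G = [forall s, ordexp h s == ordexp h' s].
Proof.
have gen x y s : <[x]>%g = <[y]>%g -> ordexp x s = ordexp y s.
  move=> xy; apply/eqP; rewrite eqn_leq !ordexp_cycle //.
    by rewrite xy cycle_id.
  by rewrite -xy cycle_id.
have vpE (x y : G) (i : 'I_n) (j : 'I_(lam i.+1))
       (s := Tagged (fun i : 'I_n => 'I_(lam i.+1)) j) :
    (vp p (m i.+1) (x i j) == vp p (m i.+1) (y i j)) = (ordexp x s == ordexp y s).
  rewrite /ordexp /oexp.
  have hx := vp_le (coord x s) p_prime (mu_gt0 s).
  have hy := vp_le (coord y s) p_prime (mu_gt0 s).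
  rewrite -[LHS](inj_in_eq (f := subn (mu s)) (D := [pred v | v <= mu s])) //.
  by move=> u v /= uM vM uv; rewrite -(subKn uM) uv subKn.
apply/existsP/forallP => [[x /existsP[y /and3P[/eqP hx /eqP hy /forallP v]]] s | hh].
  rewrite (gen _ _ _ hx) (gen _ _ _ hy); case: s => i j.
  by have /forallP/(_ j) := v i; rewrite vpE.
exists h; apply/existsP; exists h'; rewrite !eqxx /=.
by apply/forallP => i; apply/forallP => j; rewrite vpE.
Qed.

Definition etype (h : G) : exptype := [ffun s => inord (ordexp h s)].

Lemma etypeE h s : etype h s = ordexp h s :> nat.
Proof.
rewrite ffunE inordK // ltnS; apply: leq_trans (ordexp_le h s) _.
exact: (leq_bigmax s).
Qed.

Lemma expmax_etype h : expmax (etype h) = maxexp h.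
Proof. by apply: eq_bigr => s _; rewrite etypeE. Qed.

Lemma admissible_etype h : admissible (etype h).
Proof. by apply/forallP => s; rewrite etypeE ordexp_le. Qed.

Lemma cycle_in_Xset h : (<[h]>%G \in Xset [set: G]) = nonextendable (etype h).
Proof.
apply/XsetP/existsP=> [[t ht]|[t /forallP ht]]; exists t.
  by apply/forallP => s; rewrite etypeE expmax_etype.
by move=> s; have := ht s; rewrite etypeE expmax_etype.
Qed.

Lemma etype_surj o : admissible o -> exists h, etype h = o.
Proof.
move=> /forallP oa; exists (of_coord (fun s => inZp (p ^ (mu s - o s)))).
apply/ffunP => s; apply: val_inj; rewrite /= etypeE /ordexp of_coordK.
by rewrite oexp_inZp ?mu_gt0.
Qed.

Lemma card_equivalence_partition (T I : finType) (R : rel T) (D : {set T})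
    (f : T -> I) :
  {in D &, forall x y, R x y = (f x == f y)} ->
  #|equivalence_partition R D| = #|f @: D|.
Proof.
move=> Rf; pose c o := [set y in D | o == f y].
have -> : equivalence_partition R D = c @: (f @: D).
  rewrite -imset_comp; apply: eq_in_imset => x xD; apply/setP => y; rewrite !inE.
  by apply: andb_id2l => yD; rewrite Rf.
apply: card_in_imset => _ _ /imsetP[x xD ->] /imsetP[y yD ->] /setP/(_ x).
by rewrite !inE xD eqxx /= => /esym/eqP ->.
Qed.

Lemma card_sim_classes :
  #|equivalence_partition (@sim p n m lam) (Xset [set: G])| =
  #|[set o : exptype | admissible o && nonextendable o]|.
Proof.
pose gen (H : {group G}) : G := odflt 1%g [pick h | H == <[h]>%G].
have genP H : H \in Xset [set: G] -> H = <[gen H]>%G.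
  rewrite inE => /and3P[_ /cyclicP[h Hh] _]; rewrite /gen.
  case: pickP => [x /eqP // | /(_ h)].
  by rewrite -val_eqE /= Hh eqxx.
rewrite (card_equivalence_partition (f := etype \o gen)) => [|H K HX KX]; last first.
  rewrite {1}(genP H HX) {1}(genP K KX) sim_cycle /=; apply/forallP/eqP => [hk|hk s].
    by apply/ffunP => s; apply: val_inj; rewrite /= !etypeE; apply/eqP.
  by rewrite -!etypeE hk.
apply: eq_card => o; rewrite inE; apply/imsetP/andP => [[H HX ->]|[oa on]].
  by rewrite /= admissible_etype -cycle_in_Xset -genP.
have [h ho] := etype_surj oa; have hX : <[h]>%G \in Xset [set: G].
  by rewrite cycle_in_Xset ho.
exists <[h]>%G => //=; rewrite -ho.
have: sim <[h]>%G <[gen <[h]>%G]>%G by rewrite -genP // sim_cycle; apply/forallP.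
rewrite sim_cycle => /forallP hk; apply/ffunP => s.
by apply: val_inj; rewrite /= !etypeE; apply/eqP.
Qed.

Lemma card_etype (o : exptype) :
  #|[set h | etype h == o]| =
  \prod_s #|[set x : 'Z_(p ^ mu s) | oexp p (mu s) x == o s]|.
Proof.
pose F (i : 'I_n) (j : 'I_(lam i.+1)) : pred 'Z_(p ^ m i.+1) :=
  [pred x | oexp p (m i.+1) x == o (Tagged (fun i : 'I_n => 'I_(lam i.+1)) j)].
transitivity #|(family (fun i => family (F i)) : simpl_pred G)|.
  apply: eq_card => h; rewrite !inE; apply/eqP/familyP => [ho i | hF].
    by apply/familyP => j; rewrite !inE -ho etypeE.
  apply/ffunP => -[i j]; apply: val_inj; rewrite /= etypeE.
  by have /familyP/(_ j) := hF i; rewrite inE => /eqP.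
rewrite card_family foldrE big_map big_enum /=.
under eq_bigr => i _ do rewrite card_family foldrE big_map big_enum /=.
rewrite (sig_big_dep _ (fun _ _ => true)) /=.
by apply: eq_bigr => -[i j] _; apply: eq_card => x; rewrite !inE.
Qed.

Local Open Scope ring_scope.

(** Every cyclic subgroup is counted once for each of its generators, whose number
    is the totient of its order. *)
Lemma card_Xset :
  #|Xset [set: G]|%:R =
  \sum_(o : exptype | admissible o && nonextendable o)
    (totient (p ^ expmax o))%:R^-1 *
    \prod_s #|[set x : 'Z_(p ^ mu s) | oexp p (mu s) x == o s]|%:R :> rat.
Proof.
transitivity (\sum_(h | <[h]>%G \in Xset [set: G])
    (totient (p ^ expmax (etype h)))%:R^-1 : rat).
  rewrite (partition_big (fun h => <[h]>%G) (fun H => H \in Xset [set: G])) //=.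
  rewrite -sum1_card natr_sum; apply: eq_bigr => H HX.
  have /cyclicP[a Ha] : cyclic H by move: HX; rewrite inE => /and3P[].
  transitivity (\sum_(h | h \in [set x | generator <[a]> x]) (totient #[a]%g)%:R^-1 : rat).
    rewrite sumr_const -totient_gen -[RHS]mulr_natr.
    by rewrite mulVf // Num.Theory.pnatr_eq0 -lt0n totient_gt0 order_gt0.
  have genE h : (h \in [set x | generator <[a]> x]) = (<[h]>%G == H).
    by rewrite inE /generator -Ha eq_sym.
  apply: eq_big => [h | h]; rewrite genE; last first.
    by move=> /eqP hH; rewrite expmax_etype -order_maxexp /order -Ha -hH.
  by case: eqP => [-> | _]; rewrite ?HX ?andbF.
rewrite (partition_big etype (fun o => admissible o && nonextendable o)); last first.
  by move=> h; rewrite cycle_in_Xset admissible_etype.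
apply: eq_bigr => o /andP[_ on].
rewrite -natr_prod -card_etype cardsE mulr_natr -sumr_const.
apply: eq_big => h; last by case/andP=> _ /eqP ->.
by rewrite cycle_in_Xset -[RHS]/(etype h == o); case: eqP => [-> | _]; rewrite ?on ?andbF.
Qed.

End Coordinates.

Local Open Scope ring_scope.

(** * The two counting formulas *)

Lemma sum_card_fibers (T : finType) (f : T -> nat) b :
  \sum_(0 <= j < b) #|[set x | f x == j]|%:R = #|[set x | (f x < b)%N]|%:R :> rat.
Proof.
rewrite -natr_sum; congr _%:R; rewrite -sum1dep_card.
rewrite (eq_bigr (fun x => \sum_(0 <= j < b | j == f x) 1)%N) => [|x fx]; last first.
  by rewrite big_nat1_eq fx.
rewrite (exchange_big_dep xpredT) //=; apply: eq_big_nat => j /andP[_ jb].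
rewrite -sum1dep_card; apply: eq_bigl => x.
by case: (j =P f x) => [<- | /nesym/eqP/negPf]; rewrite ?jb ?eqxx ?andbF.
Qed.

Lemma prod_natrX (a : nat) (u : nat -> nat) (e : nat -> nat) i :
  \prod_(1 <= j < i) ((a ^ u j)%:R ^+ e j) = \prod_(1 <= j < i) a%:R ^+ (u j * e j) :> rat.
Proof. by apply: eq_bigr => j _; rewrite natrX exprM. Qed.

Theorem theorem1p3 (p n : nat) (m lam : nat -> nat)
    (p_prime : prime p)
    (n_ge1 : (1 <= n)%N)
    (m1_ge1 : (1 <= m 1%N)%N)
    (m_incr : forall i : nat, (1 <= i)%N -> (i < n)%N -> (m i < m i.+1)%N)
    (lam_ge1 : forall i : nat, (1 <= i)%N -> (i <= n)%N -> (1 <= lam i)%N) :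
  let X := Xset [set: abgroup p n m lam] in
  #|equivalence_partition (@sim p n m lam) X|%:R
    = sumS1 n m lam + sumS2 n m lam + sumS3 n m lam
  /\
  #|X|%:R = sumT1 p n m lam + sumT2 p n m lam + sumT3 p n m lam.
Proof.
have m_gt0 i : (0 < i <= n)%N -> (0 < m i)%N.
  case/andP; elim: i => [|[|i] IHi] // _ iln.
  by apply: leq_ltn_trans (leq0n _) (m_incr i.+1 _ _).
move=> X; rewrite /X; split.
  rewrite (card_sim_classes lam p_prime m_gt0).
  have sum_w (s : idx n lam) b : (0 < b <= (mu m s).+1)%N ->
      \sum_(0 <= j < b) (1 : rat) = b%:R.
    by move=> _; rewrite sumr_const_nat subn0.
  transitivity (\sum_(o : exptype n m lam | admissible o && nonextendable o)
     1 * weight (fun (_ : idx n lam) (_ : nat) => 1) o : rat).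
    rewrite -sum1_card natr_sum; apply: eq_big => o; rewrite inE // => _.
    by rewrite mul1r /weight big1.
  rewrite (weighted_sum m_gt0 n_ge1 m_incr lam_ge1 sum_w
    (fun=> 1)).
  rewrite /sumS1 /sumS2 /sumS3; congr (_ + _ + _).
  - by apply: eq_bigr => k _; rewrite mul1r addn1.
  - apply: eq_bigr => i _; apply: eq_bigr => k _; rewrite mul1r addn1.
    by under [in RHS]eq_bigr do rewrite addn1.
  apply: eq_bigr => i _; apply: eq_bigr => k _; rewrite mul1r !addn1.
  by under [in RHS]eq_bigr do rewrite addn1.
rewrite (card_Xset lam p_prime m_gt0).
have sum_w (s : idx n lam) b : (0 < b <= (mu m s).+1)%N ->
    \sum_(0 <= j < b) #|[set x : 'Z_(p ^ mu m s) | oexp p (mu m s) x == j]|%:R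
    = (p ^ b.-1)%:R :> rat.
  by move=> hb; rewrite sum_card_fibers card_oexp_lt // mu_gt0.
rewrite [LHS](weighted_sum m_gt0 n_ge1 m_incr lam_ge1 sum_w
  (fun k => (totient (p ^ k))%:R^-1)).
have totE k : (0 < k)%N -> (totient (p ^ k))%:R = p%:R ^+ (k - 1) * (p%:R - 1) :> rat.
  move=> k0; rewrite totient_pfactor // natrM natrX mulrC subn1; congr (_ * _).
  by rewrite -subn1 natrB // prime_gt0.
have powE k e : (p ^ k)%:R ^+ e = p%:R ^+ (k * e) :> rat by rewrite natrX exprM.
rewrite /sumT1 /sumT2 /sumT3; congr (_ + _ + _).
- by apply: eq_big_nat => k /andP[k0 _]; rewrite totE // !powE -subn1 mulrC mulrA.
- apply: eq_big_nat => i /andP[i0 iln]; apply: eq_big_nat => k /andP[mk _].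
  have k0 : (0 < k)%N by apply: leq_trans mk; apply: m_gt0; rewrite i0 ltnW.
  rewrite totE // prod_natrX !powE -!subn1 !subSS !subn0 [LHS]mulrC -[LHS]mulrA; congr (_ * _).
  by rewrite mulrC.
apply: eq_big_nat => i /andP[i0 _]; apply: eq_big_nat => k /andP[mk _].
have k0 : (0 < k)%N by apply: leq_trans mk.
rewrite totE // prod_natrX !powE -!subn1 !subSS !subn0 [LHS]mulrC -[LHS]mulrA; congr (_ * _).
by rewrite mulrC mulrA mulrAC.
Qed.
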